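(* Let $\mathcal{X}$ be a discrete set and let $\mathcal{A}$ be an $(\varepsilon,\delta)$-differentially private randomized algorithm that, given a dataset $S\in\mathcal{X}^n$, outputs a function from $\mathcal{X}$ to $[0,1]$. Let $\mathcal{P}$ be any distribution over $\mathcal{X}$, let $\mathbf{S}$ be distributed according to $\mathcal{P}^n$, and let $\boldsymbol{\phi}=\mathcal{A}(\mathbf{S})$. Then for any $\beta>0$, $\tau>0$ and $n\ge 48\ln(4/\beta)/\tau^2$, if $\varepsilon\le\tau/4$ and $\delta=\exp(-4\ln(8/\beta)/\tau)$, then $$\Pr\left[\,\left|\mathcal{P}[\boldsymbol{\phi}]-\mathcal{E}_{\mathbf{S}}[\boldsymbol{\phi}]\right|>\tau\,\right]\le\beta,$$ where the probability is over the randomness of $\mathcal{A}$ and of $\mathbf{S}$.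
   Context: For a function $\psi:\mathcal{X}\to[0,1]$, $\mathcal{P}[\psi]=\mathbb{E}_{x\sim\mathcal{P}}[\psi(x)]$, and for a dataset $S=(x_1,\dots,x_n)$, $\mathcal{E}_S[\psi]=\frac1n\sum_{i=1}^n\psi(x_i)$. Two datasets in $\mathcal{X}^n$ are adjacent if they differ in a single element. A randomized algorithm $\mathcal{A}$ with domain $\mathcal{X}^n$ is $(\varepsilon,\delta)$-differentially private if for every set $\mathcal{S}$ of outputs and every pair of adjacent datasets $x,y$, $\Pr[\mathcal{A}(x)\in\mathcal{S}]\le e^{\varepsilon}\Pr[\mathcal{A}(y)\in\mathcal{S}]+\delta$ (probability over the coins of $\mathcal{A}$). *)

(* Defs.v *)
From HB Require Import structures.
From mathcomp Require Import all_boot all_order all_algebra.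
From mathcomp Require Import all_classical all_reals all_analysis.
Set Implicit Arguments. Unset Strict Implicit. Unset Printing Implicit Defensive.
Import Order.TTheory GRing.Theory Num.Theory.
Local Open Scope classical_set_scope.
Local Open Scope ring_scope.

(* A probability distribution over the discrete set X, given by its mass
   function (countable support is automatic since the masses sum to 1). *)
Definition is_distribution (R : realType) (X : choiceType) (P : X -> R) : Prop :=
  (forall x, 0 <= P x) /\ (\esum_(x in [set: X]) (P x)%:E = 1)%E.

Definition pop_mean (R : realType) (X : choiceType) (P : X -> R) (psi : X -> R) : R :=
  fine (\esum_(x in [set: X]) (P x * psi x)%:E)%E.

Definition emp_mean (R : realType) (X : choiceType) (n : nat) (S : n.-tuple X)
  (psi : X -> R) : R :=
  n%:R^-1 * \sum_(i < n) psi (tnth S i).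

Definition adjacent (X : choiceType) (n : nat) (x y : n.-tuple X) : Prop :=
  exists i : 'I_n, forall j : 'I_n, j != i -> tnth x j = tnth y j.

(* A randomized algorithm with coins in a probability space (Omega, mu):
   A S w is the output on dataset S with coins w.
   (eps,delta)-DP: for every set O of outputs (whose preimages are events)
   and adjacent x y, Pr[A x in O] <= e^eps Pr[A y in O] + delta. *)
Definition diff_private (R : realType) (X : choiceType) (Out : Type) (n : nat)
  (d : measure_display) (Omega : measurableType d) (mu : probability Omega R)
  (A : n.-tuple X -> Omega -> Out) (eps delta : R) : Prop :=
  forall (O : set Out) (x y : n.-tuple X),
    adjacent x y ->
    measurable (A x @^-1` O) -> measurable (A y @^-1` O) ->
    (mu (A x @^-1` O) <= (expR eps)%:E * mu (A y @^-1` O) + delta%:E)%E.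

Definition joint_prob (R : realType) (X : choiceType) (n : nat)
  (d : measure_display) (Omega : measurableType d) (mu : probability Omega R)
  (P : X -> R) (E : n.-tuple X -> Omega -> Prop) : \bar R :=
  (\esum_(S in [set: n.-tuple X]) (\prod_(i < n) P (tnth S i))%:E * mu [set w | E S w])%E.

(* Main.v *)
Require Import Defs.
From HB Require Import structures.
From mathcomp Require Import all_boot all_order all_algebra.
From mathcomp Require Import all_classical all_reals all_analysis.
From mathcomp Require Import measurable_realfun ring lra.

(** Write [psi = phi - P[phi]] and bound the [k]-th moment of [1 + E_S[psi]]
    with [k] about [3 ln(4 / beta) / tau].  Expanded, it is an average over
    [I : [k] -> [n]] of products of [k] factors depending on [S] only through
    the coordinates [S_(I j)].  By group privacy these coordinates may be
    replaced by fresh ones in the input of the algorithm, at the price of a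
    factor [exp(k eps)] and an additive error [2^k k exp(k eps) delta]; swapping
    old and fresh coordinates then makes [phi] independent of the sample on
    which it is averaged.  In that case the moment is at most [exp(k^2 / n)],
    and Markov's inequality concludes. The lower tail follows by applying this
    to [1 - A]. *)

Set Implicit Arguments.
Unset Strict Implicit.
Unset Printing Implicit Defensive.
Import Order.TTheory GRing.Theory Num.Theory.
Local Open Scope classical_set_scope.
Local Open Scope ring_scope.

(** * Sums over discrete sets and product weights *)

Lemma ge0_esumZl (R : realType) (T : choiceType) (D : set T) (r : R)
    (a : T -> \bar R) : 0 <= r -> (forall i, (0 <= a i)%E) ->
  (\esum_(i in D) (r%:E * a i) = r%:E * \esum_(i in D) a i)%E.
Proof.
move=> r0 a0; rewrite /esum -ereal_supZl//; last first.
  by apply/set0P; exists (\sum_(x \in set0) a x)%E; exists set0 => //; exact: fsets_set0.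
congr ereal_sup; rewrite image_comp; apply: eq_imagel => A _ /=.
by rewrite ge0_mule_fsumr.
Qed.

(** [T] may be uncountable, so the whole sum is never integrated: each finite partial sum is
    exchanged with the integral, then bounded pointwise by [c], whose integral under a probability
    is [c]. *)
Lemma esum_integral_le (R : realType) (T : choiceType) (d : measure_display)
    (Omega : measurableType d) (mu : probability Omega R)
    (W : T -> R) (f : T -> Omega -> R) (c : R) :
  (forall t, 0 <= W t) -> (forall t w, 0 <= f t w) ->
  (forall t, measurable_fun [set: Omega] (f t)) ->
  (forall w, (\esum_(t in [set: T]) (W t * f t w)%:E <= c%:E)%E) ->
  (\esum_(t in [set: T]) ((W t)%:E * \int[mu]_w (f t w)%:E) <= c%:E)%E.
Proof.
move=> W0 f0 mf fc; apply: ge_ereal_sup => _ [F [finF _] <-].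
have mf' t : measurable_fun [set: Omega] (fun w => (W t)%:E * (f t w)%:E)%E.
  by apply: measurable_funeM; exact/measurable_EFinP.
under eq_fsbigr => t _.
  rewrite -ge0_integralZl_EFin//; last 2 first.
    by move=> w _; rewrite lee_fin.
    exact/measurable_EFinP.
  over.
rewrite fsbig_finite//= -ge0_integral_sum//; last first.
  by move=> t w _; rewrite -EFinM lee_fin mulr_ge0.
apply: (@le_trans _ _ (\int[mu]_w c%:E)%E).
  apply: ge0_le_integral => //.
  - by move=> w _; apply: sume_ge0 => t _; rewrite -EFinM lee_fin mulr_ge0.
  - exact: emeasurable_sum.
  - move=> w _; apply: le_trans (fc w); apply: esum_ge.
    by exists F => //; rewrite fsbig_finite.
by rewrite integral_cst// [X in (_ * X)%E]probability_setT mule1.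
Qed.

(** Independence of coordinates, by splitting off the head of the tuple. With [f = P] it gives total
    mass one; with [f] a tilted mass it factorises an exponential moment. *)
Lemma esum_tuple_prod (R : realType) (X : choiceType) (n : nat) (f : X -> R)
    (v : R) : (forall x, 0 <= f x) ->
  (\esum_(x in [set: X]) (f x)%:E = v%:E)%E ->
  (\esum_(S in [set: n.-tuple X]) (\prod_(i < n) f (tnth S i))%:E
   = (v ^+ n)%:E)%E.
Proof.
move=> f0 fv.
have v0 : 0 <= v.
  by rewrite -lee_fin -fv; apply: esum_ge0 => x _; rewrite lee_fin.
have pf m (S : m.-tuple X) : 0 <= \prod_(i < m) f (tnth S i).
  by apply: prodr_ge0 => i _.
elim: n => [|n IH].
  rewrite (_ : [set: 0.-tuple X] = [set [tuple]]); last first.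
    by apply/seteqP; split=> // S _ /=; rewrite tuple0.
  by rewrite esum_set1 !big_ord0 ?expr0// lee_fin.
rewrite (@reindex_esum _ (X * n.-tuple X)%type _ ([set: X] `*`` fun _ => setT) _
  (fun p => cons_tuple p.1 p.2)); last first.
  split=> //.
  - move=> [x S] [y S'] _ _ /= /(congr1 val)[-> /val_inj ->] //.
  - by move=> S _; exists (thead S, behead_tuple S) => //=; rewrite [RHS]tuple_eta; exact: val_inj.
rewrite -(esum_esum (a := fun x S => (\prod_(i < n.+1) f (tnth (cons_tuple x S) i))%:E)); last first.
  by move=> *; rewrite lee_fin.
have E x : (\esum_(S in [set: n.-tuple X])
    (\prod_(i < n.+1) f (tnth (cons_tuple x S) i))%:E = (v ^+ n)%:E * (f x)%:E)%E.
  rewrite muleC -IH -ge0_esumZl//; last by move=> S; rewrite lee_fin.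
  apply: eq_esum => S _; rewrite big_ord_recl tnth0 EFinM.
  by under eq_bigr => i _ do rewrite tnthS.
rewrite (eq_esum (fun x _ => E x)) ge0_esumZl ?exprn_ge0//.
by rewrite fv exprSr EFinM.
Qed.

(** * The population mean *)

Section pop_mean_theory.
Variables (R : realType) (X : choiceType) (P : X -> R).
Hypothesis distP : is_distribution P.

Lemma esum_pop_mean (psi : X -> R) : (forall x, 0 <= psi x <= 1) ->
  (\esum_(x in [set: X]) (P x * psi x)%:E = (pop_mean P psi)%:E)%E.
Proof.
move=> psi01; case: distP => P0 P1; rewrite /pop_mean fineK//.
rewrite ge0_fin_numE; last first.
  apply: esum_ge0 => x _; rewrite lee_fin mulr_ge0//.
  by case/andP: (psi01 x).
apply: (@le_lt_trans _ _ 1%E); last exact: ltry.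
rewrite -P1; apply: le_esum => x _; rewrite lee_fin ler_piMr//.
by case/andP: (psi01 x).
Qed.

Lemma pop_mean_affine (psi : X -> R) (a b : R) : (forall x, 0 <= psi x <= 1) ->
  0 <= a -> 0 <= b ->
  (\esum_(x in [set: X]) (P x * (a + b * psi x))%:E =
   (a + b * pop_mean P psi)%:E)%E.
Proof.
move=> psi01 a0 b0; case: distP => P0 P1.
have psi0 x : 0 <= psi x by case/andP: (psi01 x).
rewrite (eq_esum (b := fun x => (a%:E * (P x)%:E + b%:E * (P x * psi x)%:E)%E)).
  rewrite esumD; last 2 first.
  - by move=> x _; rewrite -EFinM lee_fin mulr_ge0.
  - by move=> x _; rewrite -EFinM lee_fin !mulr_ge0.
  rewrite !ge0_esumZl//; last first.
    by move=> x; rewrite lee_fin mulr_ge0.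
  by rewrite P1 esum_pop_mean// mule1.
by move=> x _; rewrite -!EFinM -EFinD; congr (_%:E); ring.
Qed.

Lemma pop_mean_ge0_le1 (psi : X -> R) : (forall x, 0 <= psi x <= 1) ->
  0 <= pop_mean P psi <= 1.
Proof.
move=> psi01; case: distP => P0 P1; rewrite -!lee_fin -esum_pop_mean//.
apply/andP; split.
  apply: esum_ge0 => x _; rewrite lee_fin mulr_ge0//.
  by case/andP: (psi01 x).
rewrite -P1; apply: le_esum => x _; rewrite lee_fin ler_piMr//.
by case/andP: (psi01 x).
Qed.

Lemma pop_mean_onem (psi : X -> R) : (forall x, 0 <= psi x <= 1) ->
  pop_mean P (fun x => 1 - psi x) = 1 - pop_mean P psi.
Proof.
move=> psi01; case: distP => P0 P1.
have psi0 x : 0 <= psi x by case/andP: (psi01 x).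
have psi1 x : 0 <= 1 - psi x by rewrite subr_ge0; case/andP: (psi01 x).
suff : ((pop_mean P (fun x => 1 - psi x))%:E + (pop_mean P psi)%:E = 1%:E)%E.
  by rewrite -EFinD => /eqP; rewrite eqe => /eqP; lra.
rewrite -P1 -!esum_pop_mean// -?esumD; first last.
- by move=> x; rewrite psi1/= lerBlDr lerDl.
- by move=> x _; rewrite lee_fin mulr_ge0.
- by move=> x _; rewrite lee_fin mulr_ge0.
by apply: eq_esum => x _; rewrite -EFinD; congr (_%:E); ring.
Qed.

(* [X] may be uncountable, so the sum is first shown to be the supremum over
   a sequence of finite sets carrying mass tending to [1]. *)
Lemma measurable_pop_mean (d : measure_display) (Omega : measurableType d)
    (f : Omega -> X -> R) : (forall w x, 0 <= f w x <= 1) ->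
  (forall x, measurable_fun [set: Omega] (f^~ x)) ->
  measurable_fun [set: Omega] (fun w => pop_mean P (f w)).
Proof.
move=> f01 mf; case: distP => P0 P1.
have f0 w x : 0 <= f w x by case/andP: (f01 w x).
have f1 w x : f w x <= 1 by case/andP: (f01 w x).
have /choice[F FP] (m : nat) : exists F : set X, finite_set F /\
    (1 - (m.+1%:R^-1)%:E <= \sum_(x \in F) (P x)%:E)%E.
  have : ((1 - m.+1%:R^-1)%:E < \esum_(x in [set: X]) (P x)%:E)%E.
    by rewrite P1 lte_fin ltrBlDr ltrDl invr_gt0.
  by move=> /ereal_sup_gt[_ [F [finF _] <-]] /ltW; exists F.
pose s m w := (\sum_(x \in F m) (P x * f w x)%:E)%E.
apply/measurable_EFinP.
rewrite (_ : _ \o _ = fun w => esups (s^~ w) 0%N); last first.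
  apply/funext => w /=; rewrite -esum_pop_mean//; apply/eqP; rewrite eq_le.
  apply/andP; split; last first.
    apply: ge_ereal_sup => _ [m _ <-]; apply: ereal_sup_ubound.
    by exists (F m) => //; split => //; exact: (FP m).1.
  apply: ge_ereal_sup => _ [G [finG _] <-].
  apply/lee_addgt0Pr => e e0.
  have [m me] : exists m, m.+1%:R^-1 < e.
    by have [m] := ltr_add_invr e0; rewrite add0r; exists m.
  have [finF FPm] := FP m.
  apply: (@le_trans _ _ (s m w + (m.+1%:R^-1)%:E)%E); last first.
    rewrite leeD// ?lee_fin ?(ltW me)//.
    by apply: ereal_sup_ubound; exists m.
  (* The part of [G] inside [F m] contributes at most [s m w]; the part outside has mass at most
     [1 / (m + 1)], because [F m] and [G] together have mass at most [1]. *)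
  rewrite (fsbigID (F m))//=.
  apply: leeD.
    rewrite /s; apply: lee_fsum_nneg_subset => //.
    - exact: finite_setIl.
    - by move=> x; rewrite inE => -[]; rewrite inE.
    - by move=> x _; rewrite lee_fin mulr_ge0.
  apply: (@le_trans _ _ (\sum_(x \in G `&` ~` F m) (P x)%:E)%E).
    apply: lee_fsum; first exact: finite_setIl.
    by move=> x _; rewrite lee_fin ler_piMr.
  have : (\sum_(x \in F m `|` G) (P x)%:E <= 1%:E)%E.
    rewrite -P1; apply: esum_ge; exists (F m `|` G) => //.
    by split => //; rewrite finite_setU.
  rewrite (fsbigID (F m)) ?finite_setU//= setUK setIUl setICr set0U => le1.
  move: FPm le1; rewrite !fsumEFin//; last exact: finite_setIl.
  rewrite -EFinB -EFinD !lee_fin => FPm le1.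
  by rewrite -(lerD2l (\sum_(i \in F m) P i)) (le_trans le1)// -lerBlDr.
apply: measurable_fun_esups => m; rewrite /s.
apply: emeasurable_fsum; first exact: (FP m).1.
by move=> x; apply/measurable_EFinP; exact: measurable_funM.
Qed.
End pop_mean_theory.

(** * Exchanging coordinates between two samples *)

Section splice.
Variables (X : choiceType) (n : nat).
Implicit Types (S T : n.-tuple X) (l : seq 'I_n).

(** A list, possibly with repetitions, makes group privacy an induction on [l] and lets [codom I]
    serve as [l]. *)
Definition splice l S T : n.-tuple X :=
  [tuple if i \in l then tnth T i else tnth S i | i < n].

Lemma tnth_splice l S T i :
  tnth (splice l S T) i = if i \in l then tnth T i else tnth S i.
Proof. exact: tnth_mktuple. Qed.

Lemma splice_nil S T : splice [::] S T = S.
Proof. by apply: eq_from_tnth => i; rewrite tnth_splice in_nil. Qed.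

Lemma spliceK l S T : splice l (splice l S T) (splice l T S) = S.
Proof. by apply: eq_from_tnth => i; rewrite !tnth_splice; case: (i \in l). Qed.

Lemma adjacent_splice_cons i l S T :
  Defs.adjacent (splice l S T) (splice (i :: l) S T).
Proof.
by exists i => j ji; rewrite !tnth_splice in_cons (negbTE ji).
Qed.

Lemma prod_splice (R : comPzRingType) (f : X -> R) l S T :
  (\prod_(i < n) f (tnth (splice l S T) i)) *
  (\prod_(i < n) f (tnth (splice l T S) i)) =
  (\prod_(i < n) f (tnth S i)) * (\prod_(i < n) f (tnth T i)).
Proof.
rewrite -!big_split; apply: eq_bigr => i _ /=; rewrite !tnth_splice.
by case: (i \in l) => //; rewrite mulrC.
Qed.

(** Exchanging the coordinates [l] between [S] and [T] is an involution on pairs that preserves the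
    joint product mass ([prod_splice]), hence a reindexing of the double sum. *)
Lemma esum_splice (R : realType) (P : X -> R) l
    (F : n.-tuple X -> n.-tuple X -> \bar R) : (forall x, 0 <= P x) ->
  (forall S T, (0 <= F S T)%E) ->
  let W S := \prod_(i < n) P (tnth S i) in
  (\esum_(S in [set: n.-tuple X]) ((W S)%:E * \esum_(T in [set: n.-tuple X])
     ((W T)%:E * F (splice l S T) (splice l T S))) =
   \esum_(S in [set: n.-tuple X]) ((W S)%:E * \esum_(T in [set: n.-tuple X])
     ((W T)%:E * F S T)))%E.
Proof.
move=> P0 F0 W.
have W0 S : 0 <= W S by apply: prodr_ge0.
have pairE G : (forall S T, (0 <= G S T)%E) ->
    (\esum_(S in [set: n.-tuple X]) ((W S)%:E * \esum_(T in [set: n.-tuple X])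
      ((W T)%:E * G S T)) =
    \esum_(p in [set: n.-tuple X] `*`` fun _ => setT)
      ((W p.1 * W p.2)%:E * G p.1 p.2))%E.
  move=> G0.
  rewrite -(esum_esum (a := fun S T => ((W S * W T)%:E * G S T)%E)); last first.
    by move=> S T _ _; rewrite mule_ge0// lee_fin mulr_ge0.
  apply: eq_esum => S _; rewrite -ge0_esumZl//; last first.
    by move=> T; rewrite mule_ge0// lee_fin.
  by apply: eq_esum => T _; rewrite EFinM muleA.
rewrite !pairE//.
pose e (p : n.-tuple X * n.-tuple X) := (splice l p.1 p.2, splice l p.2 p.1).
have eK p : e (e p) = p by case: p => S T; rewrite /e/= !spliceK.
rewrite [RHS](@reindex_esum _ _ _ ([set: n.-tuple X] `*`` fun _ => setT) _ e).
  by apply: eq_esum => p _ /=; rewrite /W prod_splice.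
split=> // [p q _ _ pq|p _]; first by rewrite -(eK p) pq eK.
by exists (e p) => //; rewrite eK.
Qed.

End splice.

(** * Differential privacy for integrals, and group privacy *)

(** Exactly [t], the integer part of [z * (m + 1)], of the levels lie below or at [z], so
    [L = t / (m + 1)] is [z] rounded down to the grid. *)
Lemma level_sum_bounds (R : realType) (m : nat) (z : R) : 0 <= z <= 1 ->
  let L := \sum_(j < m.+1) m.+1%:R^-1 * (j.+1%:R / m.+1%:R <= z)%R%:R in
  L <= z <= L + m.+1%:R^-1.
Proof.
move=> /andP[z0 z1] /=.
have m0 : 0 < m.+1%:R :> R by rewrite ltr0n.
set t := Num.trunc (z * m.+1%:R).
have tm : (t <= m.+1)%N.
  rewrite -(@ler_nat R); apply: (@le_trans _ _ (z * m.+1%:R)).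
    by rewrite truncn_le mulr_ge0.
  by rewrite ler_piMl// ltW.
have -> : \sum_(j < m.+1) m.+1%:R^-1 * (j.+1%:R / m.+1%:R <= z)%R%:R
    = t%:R / m.+1%:R :> R.
  rewrite -mulr_sumr mulrC; congr (_ / _).
  under eq_bigr => j _ do rewrite ler_pdivrMr// -truncn_gt_nat -/t.
  under eq_bigr => j _ do rewrite mulrb.
  by rewrite -big_mkcond/= (big_ord_narrow tm) sumr_const card_ord.
rewrite ler_pdivrMr// -[X in _ + X]mul1r -mulrDl ler_pdivlMr//.
by rewrite natr1 truncn_le mulr_ge0//= ltW// truncnS_gt.
Qed.

Section private_integral.
Variables (R : realType) (X : choiceType) (Out : Type) (n : nat).
Variables (d : measure_display) (Omega : measurableType d).
Variables (mu : probability Omega R) (A : n.-tuple X -> Omega -> Out).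
Variables (eps delta : R).
Hypothesis dpA : diff_private mu A eps delta.

(* Average the privacy inequality over the level sets [g >= j / m]. *)
Lemma private_integral_le1 (g : Out -> R) (x y : n.-tuple X) :
  Defs.adjacent x y -> (forall o, 0 <= g o <= 1) ->
  (forall S, measurable_fun [set: Omega] (g \o A S)) ->
  (\int[mu]_w (g (A x w))%:E <=
   (expR eps)%:E * \int[mu]_w (g (A y w))%:E + delta%:E)%E.
Proof.
move=> xy g01 mg; apply/lee_addgt0Pr => e e0.
have [m] := ltr_add_invr e0; rewrite add0r => /ltW me.
pose lev (j : 'I_m.+1) := [set o : Out | j.+1%:R / m.+1%:R <= g o].
pose L o : R := \sum_(j < m.+1) (m.+1%:R^-1 * (j.+1%:R / m.+1%:R <= g o)%R%:R).
have g0 o : 0 <= g o by case/andP: (g01 o).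
have mlev S j : measurable (A S @^-1` lev j).
  rewrite (_ : _ @^-1` _ = (g \o A S) @^-1` `[j.+1%:R / m.+1%:R, +oo[%classic).
    by rewrite -[X in measurable X]setTI; exact: mg.
  by apply/seteqP; split => w /=; rewrite in_itv/= andbT.
have m0 : 0 < m.+1%:R :> R by rewrite ltr0n.
have levE S (j : 'I_m.+1) w : ((j.+1%:R / m.+1%:R <= g (A S w))%R%:R =
    \1_(A S @^-1` lev j) w :> R).
  by rewrite indicE; congr (nat_of_bool _)%:R; apply/idP/idP; rewrite inE.
have mind S (j : 'I_m.+1) : measurable_fun [set: Omega]
    (fun w => (m.+1%:R^-1 * (j.+1%:R / m.+1%:R <= g (A S w))%R%:R)%:E : \bar R).
  apply/measurable_EFinP/measurable_funM => //.
  under eq_fun do rewrite levE.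
  exact: measurable_indic.
have intL S : (\int[mu]_w (L (A S w))%:E =
    \sum_(j < m.+1) (m.+1%:R^-1)%:E * mu (A S @^-1` lev j))%E.
  under eq_integral do rewrite /L -sumEFin.
  rewrite ge0_integral_sum//.
  apply: eq_bigr => j _.
  under eq_integral do rewrite EFinM levE.
  rewrite ge0_integralZl_EFin ?integral_indic ?setIT//.
  exact/measurable_EFinP/measurable_indic.
have mL S : measurable_fun [set: Omega] (fun w => (L (A S w))%:E : \bar R).
  rewrite (_ : (fun w => _) = fun w => \sum_(j < m.+1)
    (m.+1%:R^-1 * (j.+1%:R / m.+1%:R <= g (A S w))%R%:R)%:E)%E.
    exact: emeasurable_sum.
  by apply/funext => w; rewrite /= /L sumEFin.
have L0 o : 0 <= L o.
  by apply: sumr_ge0 => j _; rewrite mulr_ge0.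
(* For [x], [g] is bounded above by [L + 1 / (m + 1)]; for [y], it is bounded below by [L]. The
   discretisation thus costs at most [e]. *)
apply: (@le_trans _ _ (\int[mu]_w ((L (A x w))%:E + (m.+1%:R^-1)%:E))%E).
  apply: ge0_le_integral => //.
  - by move=> w _; rewrite lee_fin.
  - exact/measurable_EFinP/mg.
  - by apply: emeasurable_funD; [exact: mL|exact: measurable_cst].
  - by move=> w _; rewrite -EFinD lee_fin; case/andP: (level_sum_bounds m (g01 (A x w))).
rewrite ge0_integralD//; last by move=> w _; rewrite lee_fin.
rewrite integral_cst// [X in (_ + _ * X)%E]probability_setT mule1.
apply: leeD; last by rewrite lee_fin.
apply: (@le_trans _ _ ((expR eps)%:E * \int[mu]_w (L (A y w))%:E + delta%:E)%E); last first.
  apply: leeD => //; apply: lee_pmul => //.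
  - by apply: integral_ge0 => w _; rewrite lee_fin.
  - apply: ge0_le_integral => //.
    + by move=> w _; rewrite lee_fin.
    + exact/measurable_EFinP/mg.
    + by move=> w _; rewrite lee_fin; case/andP: (level_sum_bounds m (g01 (A y w))).
rewrite !intL.
(* [delta] is shared among the [m + 1] levels, each of weight [1 / (m + 1)], to match one use of
   [dpA] per level. *)
have -> : (delta%:E = \sum_(j < m.+1) (m.+1%:R^-1)%:E * delta%:E)%E.
  under eq_bigr => j _ do rewrite -EFinM.
  rewrite sumEFin -mulr_suml sumr_const card_ord -[_ *+ _]mulr_natr.
  by rewrite mulVf ?mul1r// gt_eqF.
rewrite ge0_sume_distrr//; last by move=> j _; rewrite mule_ge0// lee_fin.
rewrite -big_split/=; apply: lee_sum => j _.
rewrite muleCA -muleDr//.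
  by apply: lee_pmul => //; exact: dpA.
by rewrite fin_num_adde_defl.
Qed.

Lemma private_integral (c : R) (g : Out -> R) (x y : n.-tuple X) : 0 < c ->
  Defs.adjacent x y -> (forall o, 0 <= g o <= c) ->
  (forall S, measurable_fun [set: Omega] (g \o A S)) ->
  (\int[mu]_w (g (A x w))%:E <=
   (expR eps)%:E * \int[mu]_w (g (A y w))%:E + (c * delta)%:E)%E.
Proof.
move=> c0 xy g0c mg.
pose h o := c^-1 * g o.
have h01 o : 0 <= h o <= 1.
  by rewrite /h mulr_ge0 ?invr_ge0 ?(ltW c0)//=; case/andP: (g0c o) => // ? ?;
    rewrite mulrC ler_pdivrMr ?mul1r.
have intE S : (\int[mu]_w (g (A S w))%:E = c%:E * \int[mu]_w (h (A S w))%:E)%E.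
  rewrite -ge0_integralZl_EFin ?(ltW c0)//.
  - by apply: eq_integral => w _; rewrite -EFinM /h mulVKf// gt_eqF.
  - by move=> w _; rewrite lee_fin; case/andP: (h01 (A S w)).
  - by apply/measurable_EFinP; apply: measurable_funM => //; exact: mg.
rewrite !intE muleCA EFinM -muleDr ?fin_num_adde_defl//.
apply: lee_pmul => //; first by rewrite lee_fin ltW.
  by apply: integral_ge0 => w _; rewrite lee_fin; case/andP: (h01 (A x w)).
apply: private_integral_le1 => // S.
by apply: measurable_funM => //; exact: mg.
Qed.

(** Hybrid argument, replacing one coordinate of [l] at a time. The additive errors form a geometric
    sum in [expR eps], bounded by the number of its terms times [e] since [expR eps >= 1]. *)
Lemma private_integral_splice (c : R) (g : Out -> R) (l : seq 'I_n)
    (S T : n.-tuple X) : 0 < c -> 0 <= eps -> 0 <= delta ->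
  (forall o, 0 <= g o <= c) ->
  (forall S, measurable_fun [set: Omega] (g \o A S)) ->
  let e := expR eps ^+ size l in
  (\int[mu]_w (g (A S w))%:E <= e%:E * \int[mu]_w (g (A (splice l S T) w))%:E +
    ((size l)%:R * e * (c * delta))%:E)%E.
Proof.
move=> c0 eps0 delta0 g0c mg; elim: l => [|i l IH] /=.
  by rewrite splice_nil expr0 mul1e !mul0r adde0.
apply: (le_trans IH); set e := _ ^+ size l.
have e0 : 0 <= e by rewrite exprn_ge0 ?expR_ge0.
have e1 : 1 <= expR eps by rewrite -expR0 ler_expR.
have step := private_integral c0 (@adjacent_splice_cons _ _ i l S T) g0c mg.
apply: (@le_trans _ _ (e%:E * ((expR eps)%:E *
    \int[mu]_w (g (A (splice (i :: l) S T) w))%:E + (c * delta)%:E) +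
    ((size l)%:R * e * (c * delta))%:E)%E).
  apply: leeD => //; apply: lee_pmul => //.
  by apply: integral_ge0 => w _; rewrite lee_fin; case/andP: (g0c (A (splice l S T) w)).
rewrite muleDr ?fin_num_adde_defl// muleA -EFinM -addeA -EFinM -EFinD exprSr -/e.
apply: leeD => //; rewrite lee_fin -natr1 -mulrDl.
apply: ler_wpM2r; first by rewrite mulr_ge0// ltW.
have -> : e + (size l)%:R * e = ((size l)%:R + 1) * e * 1 by ring.
by rewrite mulrA ler_wpM2l// mulr_ge0// addr_ge0.
Qed.


End private_integral.

(** * Averaging and resampling under the product distribution *)

(** [c] is extended because it is applied to quantities only known to be nonnegative; if it is
    infinite, one point of positive weight makes the sum infinite. *)
Lemma esum_const_weight (R : realType) (T : choiceType) (W : T -> R)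
    (c : \bar R) : (forall t, 0 <= W t) ->
  (\esum_(t in [set: T]) (W t)%:E = 1)%E -> (0 <= c)%E ->
  (\esum_(t in [set: T]) ((W t)%:E * c) = c)%E.
Proof.
move=> W0 W1 c0.
have [c_fin|] := boolP (c \is a fin_num).
  rewrite -(fineK c_fin); under eq_esum => t _ do rewrite muleC.
  by rewrite ge0_esumZl ?W1 ?mule1 ?fine_ge0.
rewrite ge0_fin_numE// -leNgt leye_eq => /eqP ->.
have [t Wt] : exists t, 0 < W t.
  apply: contrapT => /forallNP noW; move: W1; rewrite esum1 => [/eqP|t _].
    by rewrite eqe eq_sym oner_eq0.
  by congr EFin; apply/le_anti; rewrite W0 andbT leNgt; exact/negP/noW.
apply/eqP; rewrite -leye_eq; apply: esum_ge; exists [set t] => //.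
by rewrite fsbig_set1 gt0_muley.
Qed.

Section iid_mass.
Variables (R : realType) (X : choiceType) (n : nat) (P : X -> R).
Hypothesis distP : is_distribution P.

Definition iid_mass (S : n.-tuple X) : R := \prod_(i < n) P (tnth S i).

Lemma iid_mass_ge0 S : 0 <= iid_mass S.
Proof. by apply: prodr_ge0 => i _; case: distP. Qed.

Lemma esum_iid_mass : (\esum_(S in [set: n.-tuple X]) (iid_mass S)%:E = 1)%E.
Proof. by case: distP => P0 P1; rewrite (esum_tuple_prod _ P0 P1) expr1n. Qed.

(** [F S T] stands for running the algorithm on [S] and testing its output on [T]. A dummy [T] of
    total mass one is averaged into the diagonal, the hypothesis is applied, and [esum_splice]
    undoes the exchange, leaving an independent pair. *)
Lemma esum_resample_le (l : seq 'I_n) (F : n.-tuple X -> n.-tuple X -> \bar R)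
    (e C : R) : 0 <= e -> 0 <= C -> (forall S T, (0 <= F S T)%E) ->
  (forall S T, (F S S <= e%:E * F (splice l S T) (splice l T S) + C%:E)%E) ->
  (\esum_(S in [set: n.-tuple X]) ((iid_mass S)%:E * F S S) <=
   e%:E * (\esum_(S in [set: n.-tuple X]) ((iid_mass S)%:E *
     \esum_(T in [set: n.-tuple X]) ((iid_mass T)%:E * F S T))) + C%:E)%E.
Proof.
move=> e0 C0 F0 stepF.
have eE0 : (0 <= e%:E)%E by rewrite lee_fin.
have CE0 : (0 <= C%:E)%E by rewrite lee_fin.
have F0' S T : (0 <= e%:E * F S T)%E by rewrite mule_ge0.
case: (distP) => P0 _.
have swp : (\esum_(S in [set: n.-tuple X]) ((iid_mass S)%:E *
    \esum_(T in [set: n.-tuple X]) ((iid_mass T)%:E *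
      (e%:E * F (splice l S T) (splice l T S)))) =
    \esum_(S in [set: n.-tuple X]) ((iid_mass S)%:E *
    \esum_(T in [set: n.-tuple X]) ((iid_mass T)%:E * (e%:E * F S T))))%E.
  exact: (@esum_splice X n R P l (fun S T => (e%:E * F S T)%E) P0 F0').
move: iid_mass_ge0 esum_iid_mass swp.
generalize iid_mass => W W0 W1 swp.
have WE0 S : (0 <= (W S)%:E)%E by rewrite lee_fin.
apply: (@le_trans _ _ (\esum_(S in [set: n.-tuple X]) ((W S)%:E *
    \esum_(T in [set: n.-tuple X]) ((W T)%:E *
      (e%:E * F (splice l S T) (splice l T S) + C%:E))))%E).
  apply: le_esum => S _; apply: lee_pmul => //.
  rewrite -[leLHS](esum_const_weight W0 W1)//.
  by apply: le_esum => T _; apply: lee_pmul.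
under eq_esum => S _.
  under eq_esum => T _ do rewrite muleDr ?fin_num_adde_defl//.
  rewrite esumD; last 2 first.
  - by move=> T _; rewrite mule_ge0.
  - by move=> T _; rewrite mule_ge0.
  rewrite (esum_const_weight W0 W1)// muleDr ?fin_num_adde_defl//.
  over.
rewrite esumD; last 2 first.
- by move=> S _; rewrite mule_ge0// esum_ge0// => T _; rewrite mule_ge0.
- by move=> S _; rewrite mule_ge0.
rewrite (esum_const_weight W0 W1)// leeD//.
rewrite [leLHS]swp -[leRHS]ge0_esumZl//; last first.
  by move=> S; rewrite mule_ge0// esum_ge0// => T _; rewrite mule_ge0.
apply: le_esum => S _; rewrite muleCA; apply: lee_pmul => //.
  by apply: esum_ge0 => T _; rewrite mule_ge0.
rewrite -ge0_esumZl//; last by move=> T; rewrite mule_ge0.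
by apply: le_esum => T _; rewrite muleCA.
Qed.

End iid_mass.

(* Hiding the coordinates [l] of the sample from the algorithm costs the group
   privacy factor; exchanging [S] and [T] there then makes [g] independent of
   the output. *)
Lemma private_resample (R : realType) (X : choiceType) (Out : Type) (n : nat)
    (d : measure_display) (Omega : measurableType d) (mu : probability Omega R)
    (A : n.-tuple X -> Omega -> Out) (eps delta : R) (P : X -> R) (c : R)
    (g : n.-tuple X -> Out -> R) (l : seq 'I_n) :
  diff_private mu A eps delta -> 0 <= eps -> 0 <= delta ->
  is_distribution P -> 0 < c -> (forall S o, 0 <= g S o <= c) ->
  (forall S S', measurable_fun [set: Omega] (g S \o A S')) ->
  (forall S T, g (splice l T S) = g S) ->
  let e := expR eps ^+ size l in
  (\esum_(S in [set: n.-tuple X])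
     ((iid_mass P S)%:E * \int[mu]_w (g S (A S w))%:E) <=
   e%:E * (\esum_(S in [set: n.-tuple X]) ((iid_mass P S)%:E *
     \esum_(T in [set: n.-tuple X])
        ((iid_mass P T)%:E * \int[mu]_w (g T (A S w))%:E))) +
   ((size l)%:R * e * (c * delta))%:E)%E.
Proof.
move=> dpA eps0 delta0 distP c0 g0c mg gl; cbv zeta.
have e0 : 0 <= expR eps ^+ size l by rewrite exprn_ge0 ?expR_ge0.
apply: (esum_resample_le distP (l := l)
    (F := fun S T => (\int[mu]_w (g T (A S w))%:E)%E)).
- exact: e0.
- by rewrite !mulr_ge0 ?(ltW c0).
- move=> S T; apply: integral_ge0 => w _; rewrite lee_fin.
  by case/andP: (g0c T (A S w)).
(* By [gl] the test on [splice l T S] is the test on [S], so only the input of [A] changes and group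
   privacy applies. *)
- by move=> S T; rewrite gl; apply: (private_integral_splice dpA).
Qed.


(** * Moments for a function independent of the sample *)

(** Squaring the tangent bound at [- y / 2] gives [expR y <= (1 - y / 2) ^- 2], and
    [(1 - y / 2) ^+ 2 * (1 + y + y ^+ 2)] is [1 + y ^+ 2 * (1 - 3 * y + y ^+ 2) / 4], at least [1]
    for small [y]. *)
Lemma expR_quadratic_le (R : realType) (y : R) : `|y| <= 12^-1 ->
  expR y <= 1 + y + y ^+ 2.
Proof.
rewrite ler_norml => /andP[yl yu].
have h : (1 - y / 2) ^+ 2 <= (expR y)^-1.
  rewrite -expRN (_ : - y = - (y / 2) + - (y / 2)); last by field.
  rewrite expRD -expr2 ler_sqr ?nnegrE ?expR_ge0//; last by lra.
  by have := expR_ge1Dx (- (y / 2)).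
have h0 : 0 < (1 - y / 2) ^+ 2 by rewrite exprn_gt0//; lra.
rewrite -(ler_pM2l h0) (@le_trans _ _ 1)//.
  by rewrite -ler_pdivlMr ?expR_gt0// mul1r.
nra.
Qed.

Lemma emp_mean_ge0_le1 (R : realType) (X : choiceType) (n : nat)
    (T : n.-tuple X) (phi : X -> R) :
  (forall x, 0 <= phi x <= 1) -> 0 <= emp_mean T phi <= 1.
Proof.
move=> phi01; rewrite /emp_mean.
(* For [n = 0] the inverse is [0] by convention, so the mean is [0]. *)
have [n0|n0] := posnP n.
  by rewrite (_ : n%:R^-1 = 0) ?mul0r ?lexx ?ler01// n0 invr0.
rewrite mulr_ge0/= ?sumr_ge0//; last by move=> i _; case/andP: (phi01 (tnth T i)).
rewrite ler_pdivrMl ?ltr0n// mulr1 (@le_trans _ _ (\sum_(i < n) 1))//.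
  by apply: ler_sum => i _; case/andP: (phi01 (tnth T i)).
by rewrite sumr_const card_ord.
Qed.

Section deviation.
Variables (R : realType) (X : choiceType) (P : X -> R).
Hypothesis distP : is_distribution P.

(** [(1 + x) ^+ k <= expR (k * x)] turns the moment into a product over coordinates. With
    [lam = k / n], each factor is at most [1 + lam * (phi - p) + lam ^+ 2], of mean
    [1 + lam ^+ 2 <= expR (lam ^+ 2)]; the [n]-th power is [expR (k ^+ 2 / n)]. *)
Lemma iid_moment_le (n k : nat) (phi : X -> R) : (0 < n)%N -> (12 * k <= n)%N ->
  (forall x, 0 <= phi x <= 1) ->
  (\esum_(T in [set: n.-tuple X])
     (iid_mass P T * (1 + emp_mean T phi - pop_mean P phi) ^+ k)%:E <=
   (expR (k%:R ^+ 2 / n%:R))%:E)%E.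
Proof.
move=> n0 kn phi01; case: (distP) => P0 P1.
have /andP[p0 p1] := pop_mean_ge0_le1 distP phi01.
set p := pop_mean P phi in p0 p1 *.
have nR0 : 0 < n%:R :> R by rewrite ltr0n.
pose lam : R := k%:R / n%:R.
have lam0 : 0 <= lam by rewrite divr_ge0.
have lam1 : lam <= 12^-1.
  rewrite ler_pdivrMr// mulrC ler_pdivlMr//.
  by rewrite mulrC -natrM ler_nat.
(* The quadratic bound reads [a + lam * phi], the nonnegative affine form that [pop_mean_affine]
   averages. *)
pose a := 1 + lam ^+ 2 - lam * p.
have a0 : 0 <= a by rewrite /a; nra.
apply: (@le_trans _ _ (\esum_(T in [set: n.-tuple X])
    (\prod_(i < n) (P (tnth T i) * (a + lam * phi (tnth T i))))%:E)%E).
  apply: le_esum => T _; rewrite lee_fin big_split/=.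
  apply: ler_wpM2l; first exact: iid_mass_ge0.
  apply: (@le_trans _ _ (expR (k%:R * (emp_mean T phi - p)))).
    rewrite mulrC expRM_natr; apply: lerXn2r; rewrite ?nnegrE ?expR_ge0//.
            have /andP[] := emp_mean_ge0_le1 T phi01; lra.
    by rewrite -addrA expR_ge1Dx.
  have -> : k%:R * (emp_mean T phi - p) =
      \sum_(i < n) (lam * (phi (tnth T i) - p)).
    rewrite -mulr_sumr sumrB sumr_const card_ord /lam /emp_mean -[p *+ n]mulr_natr.
    field.
    by rewrite gt_eqF.
  rewrite expR_sum; apply: ler_prod => i _; rewrite expR_ge0/=.
  have /andP[f0 f1] := phi01 (tnth T i).
  apply: le_trans (expR_quadratic_le _) _.
    rewrite normrM (ger0_norm lam0) -[leRHS]mulr1 ler_pM//.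
    by rewrite ler_norml; lra.
  have sq1 : (phi (tnth T i) - p) ^+ 2 <= 1 by nra.
  have : lam ^+ 2 * (phi (tnth T i) - p) ^+ 2 <= lam ^+ 2.
    by rewrite ler_piMr// sqr_ge0.
  rewrite /a [(lam * (_ - _)) ^+ 2]exprMn; set q := lam ^+ 2 * _ => qle.
  have -> : 1 + lam ^+ 2 - lam * p + lam * phi (tnth T i) =
    1 + lam * (phi (tnth T i) - p) + lam ^+ 2 by ring.
  by rewrite lerD2l.
rewrite (esum_tuple_prod _ _ (pop_mean_affine distP phi01 a0 lam0)); last first.
  by move=> x; rewrite mulr_ge0// addr_ge0// mulr_ge0//; case/andP: (phi01 x).
rewrite lee_fin /a -/p subrK.
have -> : k%:R ^+ 2 / n%:R = lam ^+ 2 * n%:R.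
  by rewrite /lam; field; rewrite gt_eqF.
rewrite expRM_natr; apply: lerXn2r; rewrite ?nnegrE ?expR_ge0//.
  by rewrite addr_ge0// sqr_ge0.
exact: expR_ge1Dx.
Qed.
End deviation.

(** * Moments and deviations for a private output *)

Section private_deviation.
Variables (R : realType) (X : choiceType) (n k : nat).
Variables (d : measure_display) (Omega : measurableType d).
Variables (mu : probability Omega R) (A : n.-tuple X -> Omega -> X -> R).
Variables (eps delta : R) (P : X -> R).
Hypothesis dpA : diff_private mu A eps delta.
Hypotheses (eps0 : 0 <= eps) (delta0 : 0 <= delta) (n0 : (0 < n)%N).
Hypothesis distP : is_distribution P.
Hypothesis A01 : forall S w x, 0 <= A S w x <= 1.
Hypothesis mA : forall S x, measurable_fun [set: Omega] (fun w => A S w x).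

Let excess (T : n.-tuple X) (phi : X -> R) : R :=
  emp_mean T phi - pop_mean P phi.

(** The shift by [1] makes every factor nonnegative for [phi] with values in [[0, 1]], so privacy
    can be applied term by term; [T] is read only on [codom I]. *)
Let monomial (I : {ffun 'I_k -> 'I_n}) (T : n.-tuple X) (phi : X -> R) : R :=
  \prod_(j < k) (n%:R^-1 * (1 + phi (tnth T (I j)) - pop_mean P phi)).

Let nR0 : 0 < n%:R :> R. Proof. by rewrite ltr0n. Qed.

Lemma excess_powE T phi : (1 + excess T phi) ^+ k = \sum_I monomial I T phi.
Proof.
rewrite -(bigA_distr_bigA (fun (_ : 'I_k) (i : 'I_n) =>
  n%:R^-1 * (1 + phi (tnth T i) - pop_mean P phi))).
rewrite prodr_const card_ord -mulr_sumr; congr (_ ^+ k).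
rewrite sumrB big_split/= !sumr_const card_ord /excess /emp_mean.
rewrite -[1 *+ n]mulr_natr -[pop_mean P phi *+ n]mulr_natr; field.
by rewrite gt_eqF.
Qed.

Lemma measurable_excess S T :
  measurable_fun [set: Omega] (fun w => excess T (A S w)).
Proof.
apply: measurable_funB.
  by apply: measurable_funM => //; exact: measurable_sum.
exact: measurable_pop_mean.
Qed.

Lemma measurable_monomial I S T :
  measurable_fun [set: Omega] (fun w => monomial I T (A S w)).
Proof.
apply: measurable_prod => j _; apply: measurable_funM => //.
apply: measurable_funB; last exact: measurable_pop_mean.
exact: measurable_funD.
Qed.

Lemma monomial_ge0_le I T phi : (forall x, 0 <= phi x <= 1) ->
  0 <= monomial I T phi <= (n%:R^-1 * 2) ^+ k.
Proof.
move=> phi01; have /andP[p0 p1] := pop_mean_ge0_le1 distP phi01.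
have fac j : 0 <= n%:R^-1 * (1 + phi (tnth T (I j)) - pop_mean P phi)
    <= n%:R^-1 * 2.
  have /andP[f0 f1] := phi01 (tnth T (I j)).
  rewrite mulr_ge0 ?invr_ge0 ?(ltW nR0)//=; last by lra.
  by rewrite ler_wpM2l ?invr_ge0 ?(ltW nR0)//; lra.
rewrite prodr_ge0/=; last by move=> j _; case/andP: (fac j).
rewrite -[X in _ ^+ X]card_ord -prodr_const; apply: ler_prod => j _.
exact: fac.
Qed.

(** Each monomial reads at most [k] coordinates, so [private_resample] applies to it with
    [l = codom I] and bound [(2 / n) ^+ k]. *)
Lemma private_moment_transfer :
  let e := expR eps ^+ k in
  (\esum_(S in [set: n.-tuple X])
     ((iid_mass P S)%:E * \int[mu]_w ((1 + excess S (A S w)) ^+ k)%:E) <=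
   e%:E * (\esum_(S in [set: n.-tuple X]) ((iid_mass P S)%:E *
     \esum_(T in [set: n.-tuple X])
        ((iid_mass P T)%:E * \int[mu]_w ((1 + excess T (A S w)) ^+ k)%:E))) +
   (k%:R * e * (2 ^+ k * delta))%:E)%E.
Proof.
cbv zeta; set e := _ ^+ k.
have W0 := @iid_mass_ge0 R X n P distP.
have WE0 (S : n.-tuple X) : (0 <= (iid_mass P S)%:E)%E by rewrite lee_fin; exact: W0.
have g0 I S T w : 0 <= monomial I T (A S w).
  by case/andP: (monomial_ge0_le I T (A01 S w)).
have intE S T : (\int[mu]_w ((1 + excess T (A S w)) ^+ k)%:E =
    \sum_I \int[mu]_w (monomial I T (A S w))%:E)%E.
  rewrite -ge0_integral_sum//.
  - by apply: eq_integral => w _; rewrite sumEFin excess_powE.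
  - by move=> I; apply/measurable_EFinP; exact: measurable_monomial.
  - by move=> I w _; rewrite lee_fin.
have i0 I S T : (0 <= \int[mu]_w (monomial I T (A S w))%:E)%E.
  by apply: integral_ge0 => w _; rewrite lee_fin.
have monS I : (\esum_(S in [set: n.-tuple X])
     ((iid_mass P S)%:E * \int[mu]_w (monomial I S (A S w))%:E) <=
   e%:E * (\esum_(S in [set: n.-tuple X]) ((iid_mass P S)%:E *
     \esum_(T in [set: n.-tuple X])
        ((iid_mass P T)%:E * \int[mu]_w (monomial I T (A S w))%:E))) +
   (k%:R * e * ((n%:R^-1 * 2) ^+ k * delta))%:E)%E.
  (* [private_resample] asks for bounds on every output in [X -> R], while the monomial is bounded
     only for [[0, 1]]-valued functions. Clipping repairs this and changes nothing on the outputs of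
     [A]. *)
  pose clip T phi := Num.min (Num.max (monomial I T phi) 0) ((n%:R^-1 * 2) ^+ k).
  have clipE S T w : monomial I T (A S w) = clip T (A S w).
    have /andP[m0 m1] := monomial_ge0_le I T (A01 S w).
    by rewrite /clip (max_idPl m0) (min_idPl m1).
  have sz : size (codom I) = k by rewrite size_codom card_ord.
  have c0 : 0 < (n%:R^-1 * 2) ^+ k :> R by rewrite exprn_gt0// mulr_gt0 ?invr_gt0.
  have clip01 S o : 0 <= clip S o <= (n%:R^-1 * 2) ^+ k.
    by rewrite le_min le_max lexx orbT (ltW c0)/= ge_min lexx orbT.
  have mclip S T : measurable_fun [set: Omega] (clip S \o A T).
    rewrite (_ : _ \o _ = fun w => monomial I S (A T w)).
      exact: measurable_monomial.
    by apply/funext => w; rewrite /= -clipE.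
  have clipl S T : clip (splice (codom I) T S) = clip S.
    apply/funext => phi; rewrite /clip /monomial.
    by under eq_bigr => j _ do rewrite tnth_splice codom_f.
  have := private_resample dpA eps0 delta0 distP c0 clip01 mclip clipl.
  cbv zeta; rewrite sz -/e.
  under eq_esum => S _ do under eq_integral do rewrite -clipE.
  under [X in (_ <= _ * X + _)%E]eq_esum => S _ do
    under eq_esum => T _ do under eq_integral do rewrite -clipE.
  by [].
have esum_expand (G : n.-tuple X -> {ffun 'I_k -> 'I_n} -> \bar R) :
    (forall S I, 0 <= G S I)%E ->
    (\esum_(S in [set: n.-tuple X]) ((iid_mass P S)%:E * \sum_I G S I) =
     \sum_I \esum_(S in [set: n.-tuple X]) ((iid_mass P S)%:E * G S I))%E.
  move=> G0; rewrite -esum_sum; last by move=> S I _ _; rewrite mule_ge0.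
  by apply: eq_esum => S _; rewrite ge0_sume_distrr.
under eq_esum => S _ do rewrite intE.
rewrite esum_expand//.
under [X in (_ <= _ * X + _)%E]eq_esum => S _.
  under eq_esum => T _ do rewrite intE.
  rewrite esum_expand//.
  over.
rewrite esum_expand; last first.
  by move=> S I; apply: esum_ge0 => T _; rewrite mule_ge0.
apply: le_trans (lee_sum _ (fun I _ => monS I)) _.
rewrite big_split/= ge0_sume_distrr; last first.
  move=> I _; apply: esum_ge0 => S _; rewrite mule_ge0//.
  by apply: esum_ge0 => T _; rewrite mule_ge0.
(* There are [n ^ k] monomials, each with an error proportional to [(2 / n) ^+ k]: the powers of [n]
   cancel and [2 ^+ k] remains. *)
apply: leeD => //; rewrite sumEFin lee_fin sumr_const card_ffun !card_ord.
rewrite -[leLHS]mulr_natr exprMn natrX le_eqVlt; apply/orP; left; apply/eqP.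
rewrite exprVn; field.
by rewrite expf_neq0// gt_eqF.
Qed.

Lemma private_deviation_le (tau : R) : 0 < tau -> (12 * k <= n)%N ->
  (\esum_(S in [set: n.-tuple X])
     ((iid_mass P S)%:E * mu [set w | (tau < excess S (A S w))%R]) <=
   ((1 + tau) ^- k * (expR eps ^+ k * (expR (k%:R ^+ 2 / n%:R)) +
     k%:R * expR eps ^+ k * (2 ^+ k * delta)))%:E)%E.
Proof.
move=> tau0 kn.
have W0 := @iid_mass_ge0 R X n P distP.
have WE0 (S : n.-tuple X) : (0 <= (iid_mass P S)%:E)%E by rewrite lee_fin; exact: W0.
have t0 : 0 < (1 + tau) ^+ k by rewrite exprn_gt0// addr_gt0.
have ex0 (T S : n.-tuple X) w : 0 <= 1 + excess T (A S w).
  have /andP[p0 p1] := pop_mean_ge0_le1 distP (A01 S w).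
  have /andP[m0 m1] := emp_mean_ge0_le1 T (A01 S w).
  by rewrite /excess; lra.
have mex (T S : n.-tuple X) :
    measurable_fun [set: Omega] (fun w => (1 + excess T (A S w)) ^+ k).
  apply: measurable_funX; apply: measurable_funD => //.
  exact: measurable_excess.
have int0 (T S : n.-tuple X) :
    (0 <= \int[mu]_w ((1 + excess T (A S w)) ^+ k)%:E)%E.
  by apply: integral_ge0 => w _; rewrite lee_fin exprn_ge0.
(* Markov's inequality: the indicator of the event is at most the [k]-th power of
   [(1 + excess) / (1 + tau)], whose base is nonnegative by [ex0]. *)
have markov S : (mu [set w | (tau < excess S (A S w))%R] <=
    ((1 + tau) ^- k)%:E * \int[mu]_w ((1 + excess S (A S w)) ^+ k)%:E)%E.
  have mB : measurable [set w | (tau < excess S (A S w))%R].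
    rewrite -[X in measurable X]setTI.
    have := measurable_excess S S measurableT (measurable_itv `]tau, +oo[).
    by congr measurable; apply/seteqP; split => w /=; rewrite in_itv/= andbT.
  rewrite -[X in (mu X <= _)%E]setIT -integral_indic// -ge0_integralZl_EFin//; first last.
  - by rewrite invr_ge0 ltW.
  - exact/measurable_EFinP/mex.
  - by move=> w _; rewrite lee_fin exprn_ge0.
  apply: ge0_le_integral => //.
  - exact/measurable_EFinP/measurable_indic.
  - by apply: measurable_funeM; exact/measurable_EFinP/mex.
  - move=> w _; rewrite -EFinM lee_fin indicE mulrC ler_pdivlMr//.
    case: (boolP (w \in _)) => [|_]; last by rewrite mul0r exprn_ge0.
    rewrite inE/= => /ltW tauw; rewrite mul1r lerXn2r ?nnegrE ?lerD2l//.
    by rewrite addr_ge0// ltW.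
apply: (@le_trans _ _ (((1 + tau) ^- k)%:E * \esum_(S in [set: n.-tuple X])
    ((iid_mass P S)%:E * \int[mu]_w ((1 + excess S (A S w)) ^+ k)%:E))%E).
  rewrite -ge0_esumZl ?invr_ge0 ?(ltW t0)//; last by move=> S; rewrite mule_ge0.
  apply: le_esum => S _; rewrite muleCA; apply: lee_pmul => //.
rewrite EFinM; apply: lee_pmul => //.
- by rewrite lee_fin invr_ge0 ltW.
- by apply: esum_ge0 => S _; rewrite mule_ge0.
apply: (le_trans private_moment_transfer); cbv zeta; rewrite EFinD.
apply: leeD => //; rewrite EFinM; apply: lee_pmul => //.
  apply: esum_ge0 => S _; rewrite mule_ge0//.
  by apply: esum_ge0 => T _; rewrite mule_ge0.
rewrite -[leRHS](esum_const_weight W0 (esum_iid_mass n distP)) ?lee_fin ?expR_ge0//.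
apply: le_esum => S _; apply: lee_pmul => //.
  by apply: esum_ge0 => T _; rewrite mule_ge0.
(* For fixed input [S] and coins [w], [A S w] is a fixed function independent of [T], so
   [iid_moment_le] applies. *)
apply: esum_integral_le => // [T w|w].
  by rewrite exprn_ge0.
under eq_esum => T _ do rewrite /excess addrA.
exact: iid_moment_le.
Qed.
End private_deviation.

(** * Numerical estimates and the choice of the moment order *)

Section numeric_bounds.
Variable R : realType.
Implicit Types (x tau beta L : R).

Lemma expR_natl_ge_expr x (m : nat) : 0 <= 1 + x ->
  (1 + x) ^+ m <= expR (m%:R * x).
Proof.
by move=> x0; rewrite expRM_natl lerXn2r ?nnegrE ?expR_ge0// expR_ge1Dx.
Qed.

(** [expR (- (2 / 3))] is the twelfth power of [expR (- 18^-1)], and [(17 / 18) ^+ 12 >= 1 / 2]. *)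
Lemma expR_two_thirds_le2 : expR (2 / 3) <= 2 :> R.
Proof.
have : (2 : R)^-1 <= expR (12%:R * - (18^-1)).
  by apply: le_trans (expR_natl_ge_expr 12 _); lra.
rewrite (_ : 12%:R * - _ = - (2 / 3)); last by field.
by rewrite expRN lef_pV2 ?posrE ?expR_gt0.
Qed.

Lemma expR_half_le2 : expR (2^-1) <= 2 :> R.
Proof.
by apply: le_trans expR_two_thirds_le2; rewrite ler_expR; lra.
Qed.

(** Rests on [(9 / 8) ^+ 6 >= 2]. *)
Lemma expR_three_quarters_ge2 : 2 <= expR (3 / 4) :> R.
Proof.
have : 2 <= expR (6%:R * 8^-1) :> R.
  by apply: le_trans (expR_natl_ge_expr 6 _); lra.
by rewrite (_ : 6%:R * _ = 3 / 4)//; field.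
Qed.

(* The chord bound [exp (2 tau / 3) <= 1 - tau + tau * exp (2 / 3)], read off
   from the tangent at [2 tau / 3]. *)
Lemma expR_le_onep tau : 0 <= tau <= 1 -> expR (2 / 3 * tau) <= 1 + tau.
Proof.
move=> /andP[t0 t1]; set c := 2 / 3 * tau.
have h0 : expR c * (1 - c) <= 1.
  by rewrite -ler_pdivlMl ?expR_gt0// mulr1 -expRN expR_ge1Dx.
have h1 : expR c * (1 + (2 / 3 - c)) <= expR (2 / 3).
  have -> : expR (2 / 3) = expR c * expR (2 / 3 - c).
    by rewrite -expRD addrCA subrr addr0.
  by rewrite ler_wpM2l ?expR_ge0// expR_ge1Dx.
have h2 := expR_two_thirds_le2.
have g0 : (1 - tau) * (expR c * (1 - c)) <= (1 - tau) * 1.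
  by rewrite ler_wpM2l// subr_ge0.
have g1 : tau * (expR c * (1 + (2 / 3 - c))) <= tau * 2.
  by rewrite ler_wpM2l// (le_trans h1).
(* With weights [1 - tau] and [tau], the coefficients of [expR c] add up to
   [1 - c + 2 / 3 * tau = 1]. *)
have -> : expR c = (1 - tau) * (expR c * (1 - c)) +
    tau * (expR c * (1 + (2 / 3 - c))) by rewrite /c; ring.
lra.
Qed.

Lemma ln2_ge_half : 2^-1 <= ln 2 :> R.
Proof. by rewrite -ler_expR lnK ?posrE// expR_half_le2. Qed.

(** [(1 + k / 4) ^+ 2 - k] is the square of [k / 4 - 1]. *)
Lemma natr_le_expR_half (k : nat) : k%:R <= expR (k%:R / 2) :> R.
Proof.
have k0 : 0 <= k%:R :> R by [].
apply: (@le_trans _ _ ((1 + k%:R / 4) ^+ 2)).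
  rewrite -subr_ge0 (_ : _ - _ = (k%:R / 4 - 1) ^+ 2) ?sqr_ge0//.
  by field.
have := @expR_natl_ge_expr (k%:R / 4) 2.
rewrite (_ : 2%:R * (k%:R / 4) = k%:R / 2); last by field.
by apply; rewrite addr_ge0// divr_ge0.
Qed.

Lemma moment_order_exists (n : nat) beta tau : 0 < beta < 1 -> 0 < tau < 1 ->
  48 * ln (4 / beta) / tau ^+ 2 <= n%:R ->
  exists2 k : nat, (12 * k <= n)%N &
    let delta := expR (- (4 * ln (8 / beta) / tau)) in
    (1 + tau) ^- k * (expR (tau / 4) ^+ k * expR (k%:R ^+ 2 / n%:R) +
      k%:R * expR (tau / 4) ^+ k * (2 ^+ k * delta)) <= beta / 2.
Proof.
move=> /andP[b0 b1] /andP[t0 t1]; set L := ln (4 / beta) => nL.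
have ln2 := ln2_ge_half.
have L1 : 1 <= L.
  rewrite /L ln_div ?posrE// (_ : 4 = 2 * 2 :> R); last by ring.
  rewrite lnM ?posrE//; have := @ln_le0 R beta (ltW b1); lra.
have L8 : ln (8 / beta) = L + ln 2.
  rewrite /L -lnM ?posrE ?divr_gt0//; congr ln; ring.
have Lt1 : 1 <= L / tau by rewrite ler_pdivlMr// mul1r; lra.
have n_ge : 48 * (L / tau) <= tau * n%:R.
  have -> : 48 * (L / tau) = tau * (48 * L / tau ^+ 2).
    by field; rewrite gt_eqF.
  by rewrite ler_wpM2l// ltW.
(* The successor gives [3 * L / tau <= k <= 3 * L / tau + 1], and [k <= 4 * L / tau] since
   [L / tau >= 1]; hence [12 * k <= tau * n]. *)
pose k := (Num.trunc (3 * (L / tau))).+1.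
have ku : k%:R <= 3 * (L / tau) + 1.
  by rewrite /k -natr1 lerD2r truncn_le; lra.
exists k.
  rewrite -(ler_nat R) natrM; apply: (@le_trans _ _ (48 * (L / tau))).
    by move: ku; lra.
  by apply: (le_trans n_ge); rewrite ler_piMl// ltW.
cbv zeta.
have kl : 3 * (L / tau) <= k%:R by rewrite ltW// truncnS_gt.
have nR0 : 0 < n%:R :> R.
  by rewrite -(pmulr_rgt0 _ t0); lra.
have klt : 3 * L <= k%:R * tau.
  by move: kl; rewrite mulrA ler_pdivrMr.
have kn : k%:R ^+ 2 / n%:R <= k%:R * tau / 12.
  rewrite expr2 -!mulrA ler_wpM2l// ler_pdivrMr// mulrAC; lra.
have expL : expR (- L) = beta / 4.
  by rewrite expRN lnK ?posrE ?divr_gt0// invf_div.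
have inv_le : (1 + tau) ^- k <= expR (- (2 / 3 * (k%:R * tau))).
  rewrite expRN lef_pV2 ?posrE ?exprn_gt0 ?expR_gt0 ?addr_gt0//.
  rewrite (_ : 2 / 3 * (k%:R * tau) = k%:R * (2 / 3 * tau)); last by ring.
  rewrite expRM_natl lerXn2r ?nnegrE ?expR_ge0 ?addr_ge0 ?(ltW t0)//.
  by rewrite expR_le_onep// !ltW.
have i0 : 0 <= (1 + tau) ^- k by rewrite invr_ge0 exprn_ge0// addr_ge0// ltW.
rewrite -expRM_natl.
(* In units of [k * tau] the exponent is at most [- 2 / 3 + 1 / 4 + 1 / 12 = - 1 / 3], and
   [k * tau >= 3 * L]. *)
have fst : (1 + tau) ^- k * (expR (k%:R * (tau / 4)) * expR (k%:R ^+ 2 / n%:R))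
    <= beta / 4.
  rewrite -expRD -expL.
  apply: (@le_trans _ _ (expR (- (2 / 3 * (k%:R * tau))) *
    expR (k%:R * (tau / 4) + k%:R ^+ 2 / n%:R))).
    by rewrite ler_wpM2r ?expR_ge0.
  by rewrite -expRD ler_expR; move: klt kn; clear; lra.
(* Here [k <= expR (k / 2)] and [2 ^+ k <= expR (3 * k / 4)] cost
   [5 * k / 4 <= 15 / 4 * L / tau + 5 / 4], which the exponent [- 4 * (L + ln 2) / tau] of [delta]
   absorbs. *)
have snd : (1 + tau) ^- k * (k%:R * expR (k%:R * (tau / 4)) *
    (2 ^+ k * expR (- (4 * ln (8 / beta) / tau)))) <= beta / 4.
  apply: (@le_trans _ _ (expR (- (2 / 3 * (k%:R * tau))) *
    (expR (k%:R / 2) * expR (k%:R * (tau / 4)) *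
    (expR (k%:R * (3 / 4)) * expR (- (4 * ln (8 / beta) / tau)))))).
    apply: ler_pM => //.
    apply: ler_pM; rewrite ?mulr_ge0 ?expR_ge0 ?exprn_ge0//.
      by rewrite ler_wpM2r ?expR_ge0// natr_le_expR_half.
    rewrite ler_wpM2r ?expR_ge0// expRM_natl.
    by rewrite lerXn2r ?nnegrE ?expR_ge0// expR_three_quarters_ge2.
  rewrite -!expRD -expL ler_expR L8.
  have -> : 4 * (L + ln 2) / tau = 4 * (L / tau) + 4 * (ln 2 / tau) by field; rewrite gt_eqF.
  have l2t : 2^-1 <= ln 2 / tau.
    by rewrite ler_pdivlMr//; move: ln2 t1; clear; lra.
  by move: klt ku l2t L1 Lt1; clear; lra.
rewrite mulrDr (_ : beta / 2 = beta / 4 + beta / 4) ?lerD//.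
by field.
Qed.
End numeric_bounds.

(** * From one-sided bounds to the two-sided theorem *)

(** Serves to replace [eps], whose sign is unknown, by the nonnegative [tau / 4] of the numerical
    bounds. *)
Lemma diff_private_le (R : realType) (X : choiceType) (Out : Type) (n : nat)
    (d : measure_display) (Omega : measurableType d) (mu : probability Omega R)
    (A : n.-tuple X -> Omega -> Out) (eps eps' delta : R) : eps <= eps' ->
  diff_private mu A eps delta -> diff_private mu A eps' delta.
Proof.
move=> le_eps dpA O x y xy mx my; apply: (le_trans (dpA O x y xy mx my)).
by rewrite leeD2r// lee_wpmul2r// lee_fin ler_expR.
Qed.

(** Post-processing: an event about [f (A S w)] is an event about [A S w] through the preimage under
    [f]. *)
Lemma diff_private_comp (R : realType) (X : choiceType) (Out Out' : Type)
    (n : nat) (d : measure_display) (Omega : measurableType d)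
    (mu : probability Omega R) (f : Out -> Out')
    (A : n.-tuple X -> Omega -> Out) (eps delta : R) :
  diff_private mu A eps delta ->
  diff_private mu (fun S w => f (A S w)) eps delta.
Proof. by move=> dpA O; exact: (dpA (f @^-1` O)). Qed.

Section accuracy.
Variables (R : realType) (X : choiceType) (n : nat).
Variables (d : measure_display) (Omega : measurableType d).
Variables (mu : probability Omega R) (P : X -> R).
Variables (eps delta beta tau : R).
Hypotheses (distP : is_distribution P).
Hypotheses (beta01 : 0 < beta < 1) (tau01 : 0 < tau < 1).
Hypothesis n_ge : 48 * ln (4 / beta) / tau ^+ 2 <= n%:R.
Hypothesis eps_le : eps <= tau / 4.
Hypothesis deltaE : delta = expR (- (4 * ln (8 / beta) / tau)).

Lemma sample_size_gt0 : (0 < n)%N.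
Proof.
have /andP[b0 b1] := beta01; have /andP[t0 _] := tau01.
rewrite -(ltr0n R); apply: lt_le_trans n_ge.
rewrite divr_gt0 ?exprn_gt0// mulr_gt0// ln_gt0// ltr_pdivlMr// mul1r.
by apply: lt_trans b1 _; lra.
Qed.

Lemma one_sided_accuracy (A : n.-tuple X -> Omega -> X -> R) :
  (forall S w x, 0 <= A S w x <= 1) ->
  (forall S x, measurable_fun [set: Omega] (fun w => A S w x)) ->
  diff_private mu A eps delta ->
  (\esum_(S in [set: n.-tuple X]) ((iid_mass P S)%:E *
     mu [set w | (tau < emp_mean S (A S w) - pop_mean P (A S w))%R]) <=
   (beta / 2)%:E)%E.
Proof.
move=> A01 mA dpA; have /andP[t0 _] := tau01.
have [k kn] := moment_order_exists beta01 tau01 n_ge.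
cbv zeta; rewrite -deltaE => bound.
have delta0 : 0 <= delta by rewrite deltaE expR_ge0.
have tau40 : 0 <= tau / 4 by rewrite divr_ge0// ltW.
have := private_deviation_le (diff_private_le eps_le dpA) tau40 delta0
  sample_size_gt0 distP A01 mA t0 kn.
by move=> /le_trans; apply; rewrite lee_fin.
Qed.

End accuracy.

Theorem theorem3p3 (R : realType) (X : choiceType) (n : nat)
  (d : measure_display) (Omega : measurableType d) (mu : probability Omega R)
  (A : n.-tuple X -> Omega -> (X -> R)) (P : X -> R)
  (eps delta beta tau : R) :
  (forall S w x, 0 <= A S w x <= 1) ->
  (forall S x, measurable_fun [set: Omega] (fun w => A S w x)) ->
  diff_private mu A eps delta ->
  is_distribution P ->
  0 < beta -> 0 < tau ->
  48 * ln (4 / beta) / tau ^+ 2 <= n%:R ->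
  eps <= tau / 4 ->
  delta = expR (- (4 * ln (8 / beta) / tau)) ->
  (joint_prob mu P
     (fun S w => (tau < `| pop_mean P (A S w) - emp_mean S (A S w) |)%R)
   <= beta%:E)%E.
Proof.
move=> A01 mA dpA distP b0 t0 n_ge eps_le deltaE.
rewrite /joint_prob.
have W0 := @iid_mass_ge0 R X n P distP.
have WE0 (S : n.-tuple X) : (0 <= (iid_mass P S)%:E)%E by rewrite lee_fin; exact: W0.
pose up S := [set w | tau < emp_mean S (A S w) - pop_mean P (A S w)].
pose dn S := [set w | tau < pop_mean P (A S w) - emp_mean S (A S w)].
have devE S : [set w | tau < `|pop_mean P (A S w) - emp_mean S (A S w)|] =
    up S `|` dn S.
  by apply/seteqP; split => w /=; rewrite lter_normr opprB orbC => /orP.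
under eq_esum => S _ do rewrite -/(iid_mass P S) devE.
have mpre S D : measurable D ->
    measurable [set w | D (emp_mean S (A S w) - pop_mean P (A S w))].
  by move=> /(measurable_excess distP A01 mA S S measurableT); rewrite setTI.
have mup S : measurable (up S).
  rewrite (_ : up S = [set w |
    `]tau, +oo[%classic (emp_mean S (A S w) - pop_mean P (A S w))]).
    exact: mpre.
  by apply/seteqP; split => w /=; rewrite in_itv/= andbT.
have mdn S : measurable (dn S).
  rewrite (_ : dn S = [set w |
    `]-oo, (- tau)[%classic (emp_mean S (A S w) - pop_mean P (A S w))]).
    exact: mpre.
  by apply/seteqP; split => w /=; rewrite in_itv/= ltrNr opprB.
(* Degenerate ranges first: for [beta >= 1] any probability is small enough, and for [tau >= 1] the
   event is empty because both means lie in [[0, 1]]. *)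
have [b1|b1] := leP 1 beta.
  apply: (@le_trans _ _ 1%E); last by rewrite lee_fin.
  rewrite -(esum_iid_mass n distP); apply: le_esum => S _.
  rewrite -[leRHS]mule1; apply: lee_pmul => //.
  by rewrite probability_le1//; exact: measurableU.
have [t1|t1] := leP 1 tau.
  rewrite esum1 ?lee_fin ?ltW// => S _.
  rewrite -devE (_ : [set w | _] = set0) ?measure0 ?mule0//.
  apply/seteqP; split => w //=; apply/negP; rewrite -leNgt.
  have /andP[p0 p1] := pop_mean_ge0_le1 distP (A01 S w).
  have /andP[m0 m1] := emp_mean_ge0_le1 S (A01 S w).
  by apply: le_trans t1; rewrite ler_norml; lra.
have beta01 : 0 < beta < 1 by rewrite b0.
have tau01 : 0 < tau < 1 by rewrite t0.
have n0 := sample_size_gt0 beta01 tau01 n_ge.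
(* The complement stays private by post-processing and exchanges the two tails. *)
pose B S w x := 1 - A S w x.
have B01 S w x : 0 <= B S w x <= 1.
  by have := A01 S w x; rewrite /B; lra.
have mB S x : measurable_fun [set: Omega] (fun w => B S w x).
  exact: measurable_funB.
have BE S w : emp_mean S (B S w) - pop_mean P (B S w) =
    pop_mean P (A S w) - emp_mean S (A S w).
  rewrite pop_mean_onem// /emp_mean sumrB sumr_const card_ord -[1 *+ n]mulr_natr.
  by field; rewrite pnatr_eq0 -lt0n.
have dpB : diff_private mu B eps delta.
  exact: (diff_private_comp (f := fun (phi : X -> R) x => 1 - phi x) dpA).
have upA := one_sided_accuracy distP beta01 tau01 n_ge eps_le deltaE A01 mA dpA.
have upB := one_sided_accuracy distP beta01 tau01 n_ge eps_le deltaE B01 mB dpB.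
(* Union bound, with [beta / 2] for each tail. *)
rewrite (_ : beta = beta / 2 + beta / 2); last by field.
rewrite EFinD; apply: le_trans (leeD upA upB).
rewrite -esumD; last 2 first.
- by move=> S _; rewrite mule_ge0.
- by move=> S _; rewrite mule_ge0.
apply: le_esum => S _; rewrite -ge0_muleDr//; apply: lee_pmul => //.
under [X in (_ <= _ + mu X)%E]eq_set do rewrite BE.
exact: measureU2.
Qed.
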